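(* Consider the band model without lower bounding functions, $\mathscr G_j=\{G_j: 0\le g_j\le g_j^U\}$, $j\in\{0,1\}$. Let $(\hat g_0,\hat g_1)$ be the least favorable densities, for which the stationarity conditions $$\frac{\hat g_1}{\hat g_0}=\frac1{k_2}\ \text{ on }\{y:\hat g_0<g_0^U\},\qquad \frac{\hat g_1}{\hat g_0}=k_1\ \text{ on }\{y:\hat g_1<g_1^U\}$$ hold with positive constants $k_1,k_2$ determined by the normalization constraints. Let $t_l=1/k_2$, $t_u=k_1$ and $l=g_1^U/g_0^U$. Then the least favorable distributions and the corresponding likelihood ratio function are unique and given by $$\hat g_0=\begin{cases}g_0^U,& l\ge t_l,\\ \frac1{t_l}g_1^U,& l<t_l,\end{cases}\qquad \hat g_1=\begin{cases}g_1^U,& l\le t_u,\\ t_ug_0^U,& l>t_u,\end{cases}$$ and $$\frac{\hat g_1}{\hat g_0}=\begin{cases}t_l,& l<t_l,\\ l,& t_l\le l\le t_u,\\ t_u,& l>t_u.\end{cases}$$ Moreover, all the Lagrangian constraints (the bounds $0\le\hat g_j\le g_j^U$ and the unit-mass constraints) are satisfied, and in particular the least favorable distributions are obtained by solving $$\int_{l\ge t_l}g_0^U\,d\mu+\frac1{t_l}\int_{l<t_l}g_1^U\,d\mu=1,\qquad \int_{l\le t_u}g_1^U\,d\mu+t_u\int_{l>t_u}g_0^U\,d\mu=1.$$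
   Context: All densities are with respect to a measure $\mu$ on $\Omega$; $g_j$ is the density of the probability measure $G_j$. The bounding functions $g_0^U,g_1^U$ are non-negative with $\int_\Omega g_j^U\,d\mu\ge1$; e.g. $g_j^U=(1+\epsilon_j)f_j$ with nominal densities $f_j$ and $\epsilon_j>0$ (the upper $\epsilon$-contamination model). Standing assumption for band models: the classes are nonempty and the bounding functions are chosen so that $\mathscr G_0\cap\mathscr G_1=\emptyset$ (so $g_0$ and $g_1$ are always distinct densities). For $u\in(0,1)$ let $D_u(G_0,G_1)=\int_\Omega g_1^ug_0^{1-u}\,d\mu$. The least favorable distributions are the solution of $\min_{u\in(0,1)}\max_{(G_0,G_1)\in\mathscr G_0\times\mathscr G_1}D_u(G_0,G_1)$ (they maximize $D_u$ over $\mathscr G_0\times\mathscr G_1$ for the minimizing $u$). The stationarity conditions in the claim are the first-order Lagrangian conditions of this maximization on the regions where the upper bounds are inactive. *)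

(* Defs.v *)
From HB Require Import structures.
From mathcomp Require Import all_boot all_order all_algebra.
From mathcomp Require Import all_classical all_reals all_analysis.

Set Implicit Arguments.
Unset Strict Implicit.
Unset Printing Implicit Defensive.

Import Order.TTheory GRing.Theory Num.Theory.
Import numFieldNormedType.Exports.

Local Open Scope classical_set_scope.
Local Open Scope ring_scope.
Local Open Scope ereal_scope.

(* In \bar R, 0^-1 = +oo and 0 * +oo = 0: the ratio g1 / g0 is +oo where
   g0 = 0 < g1, and has the junk value 0 where g0 = g1 = 0. *)
Definition density_ratio (T : Type) (R : realType) (g1 g0 : T -> R) (w : T) :
  \bar R :=
  (g1 w)%:E / (g0 w)%:E.

Section band_model.
Context d (T : measurableType d) (R : realType).
Variable mu : {measure set T -> \bar R}.
Implicit Types (g gU : T -> R) (t u c : R) (w : T).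

(* A class of probability measures dominated by mu is represented by the set of
   all their densities, so it is closed under mu-a.e. equality, and two classes
   have a measure in common iff the two sets of densities intersect. *)
Definition band gU : set (T -> R) :=
  [set g : T -> R | [/\ measurable_fun setT g,
                        {ae mu, forall w, (0 <= g w <= gU w)%R} &
                        \int[mu]_w (g w)%:E = 1]].

Definition affinity u g0 g1 : \bar R :=
  \int[mu]_w ((g1 w `^ u * g0 w `^ (1 - u))%R)%:E.

Definition max_affinity gU0 gU1 u : \bar R :=
  ereal_sup [set affinity u p.1 p.2 | p in band gU0 `*` band gU1].

Definition least_favorable gU0 gU1 g0 g1 : Prop :=
  [/\ band gU0 g0, band gU1 g1 &
      exists u : R,
        [/\ (0 < u < 1)%R,
            forall v : R, (0 < v < 1)%R ->
              max_affinity gU0 gU1 u <= max_affinity gU0 gU1 v &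
            affinity u g0 g1 = max_affinity gU0 gU1 u]].

(* g1 / g0 = c on {g0 < gU0} and on {g1 < gU1} respectively.  The second
   disjuncts only exempt points where the ratio reads 0 / 0 because the other
   density is forced to vanish by its own upper bound; bounding functions with
   different supports are thereby allowed.  For c > 0 the first disjuncts
   entail that g0 and g1 are both nonzero. *)
Definition stationary0 gU0 gU1 g0 g1 c : Prop :=
  {ae mu, forall w, (g0 w < gU0 w)%R ->
    density_ratio g1 g0 w = c%:E \/ (g0 w = 0%R /\ gU1 w = 0%R)}.

Definition stationary1 gU0 gU1 g0 g1 c : Prop :=
  {ae mu, forall w, (g1 w < gU1 w)%R ->
    density_ratio g1 g0 w = c%:E \/ (g1 w = 0%R /\ gU0 w = 0%R)}.

Definition normalization0 gU0 gU1 t : Prop :=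
  \int[mu]_(w in [set w | t%:E <= density_ratio gU1 gU0 w]) (gU0 w)%:E
  + (t^-1)%R%:E *
    \int[mu]_(w in [set w | density_ratio gU1 gU0 w < t%:E]) (gU1 w)%:E = 1.

Definition normalization1 gU0 gU1 t : Prop :=
  \int[mu]_(w in [set w | density_ratio gU1 gU0 w <= t%:E]) (gU1 w)%:E
  + t%:E *
    \int[mu]_(w in [set w | t%:E < density_ratio gU1 gU0 w]) (gU0 w)%:E = 1.

End band_model.

Section clipped_densities.
Context (T : Type) (R : realType).
Implicit Types (gU : T -> R) (t : R).

Definition clipped0 gU0 gU1 t : T -> R := fun w =>
  if t%:E <= density_ratio gU1 gU0 w then gU0 w else (t^-1 * gU1 w)%R.

Definition clipped1 gU0 gU1 t : T -> R := fun w =>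
  if density_ratio gU1 gU0 w <= t%:E then gU1 w else (t * gU0 w)%R.

End clipped_densities.

(* Main.v *)
Require Import Defs.
From HB Require Import structures.
From mathcomp Require Import all_boot all_order all_algebra.
From mathcomp Require Import all_classical all_reals all_analysis.
From mathcomp Require Import measurable_realfun lra ring.

Set Implicit Arguments.
Unset Strict Implicit.
Unset Printing Implicit Defensive.

Import Order.TTheory GRing.Theory Num.Theory.
Import numFieldNormedType.Exports.

Local Open Scope classical_set_scope.
Local Open Scope ring_scope.
Local Open Scope ereal_scope.

(* Put x0 = min(gU0, gU1 / tl) and x1 = min(gU1, tu * gU0), the clipped pair.
   If both have mass 1 then tl < 1 < tu: for tl >= 1 (resp. tu <= 1) the density
   x0 (resp. x1) would lie in both classes.  Integrating the tangent inequality
   of the concave map (g0, g1) |-> g1^v g0^(1-v) at (x0, x1) then shows that the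
   clipped pair is the unique maximizer of D_v for every v at once, which gives
   uniqueness and the converse statement whatever the minimizing u.

   It remains to see that a stationary maximizer is clipped.  If g0 takes values
   strictly between 0 and gU0 on a set of positive measure, moving mass of g0
   towards that set shows g1 >= tl * g0, the inequality which the stationarity
   conditions omit on {g0 = gU0}; otherwise x0 <= g0, and both
   have mass 1.  The statements for g1 follow by exchanging the two classes. *)

(** * Tangent bounds and weighted AM-GM for real powers *)

Section powR_inequalities.
Local Open Scope ring_scope.
Context (R : realType).
Implicit Types (a b r t v x y z : R).

Lemma ln_lt_sub1 x : 0 < x -> x != 1 -> ln x < x - 1.
Proof.
move=> x0 x1; rewrite -ltr_expR lnK ?posrE//.
by have := @expR_gt1Dx R (x - 1); rewrite subr_eq0 addrC subrK; exact.
Qed.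

(** Strict concavity of the logarithm: ln x < x - 1 is used at z / c and at 1 / c with weights v and
    1 - v. The right-hand sides then add up to 0, and the left-hand sides to v ln z - ln c. *)
Lemma powR_lt_tangent v z : 0 < v < 1 -> 0 < z -> z != 1 ->
  z `^ v < 1 + v * (z - 1).
Proof.
move=> /andP[v0 v1] z0 z1; set c := 1 + v * (z - 1).
have c0 : 0 < c by rewrite /c; nra.
have c1 : c != 1.
  rewrite /c -subr_eq0 addrAC subrr add0r mulf_eq0 negb_or gt_eqF//=.
  by rewrite subr_eq0.
have zc : z / c != 1.
  apply/eqP => /(congr1 ( *%R^~ c)); rewrite divfK ?gt_eqF// mul1r => zc.
  have : (1 - v) * (z - 1) == 0 by apply/eqP; move: zc; rewrite /c; lra.
  by rewrite mulf_eq0 !subr_eq0 (negbTE z1) orbF gt_eqF.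
have c'1 : c^-1 != 1 by rewrite invr_eq1.
have := ln_lt_sub1 (divr_gt0 z0 c0) zc; rewrite ln_div ?posrE// => h1.
have := ln_lt_sub1 _ c'1; rewrite invr_gt0 => /(_ c0).
rewrite lnV ?posrE// => h2.
have e : v * (z / c - 1) + (1 - v) * (c^-1 - 1) = 0.
  by rewrite /c; field; exact: lt0r_neq0.
rewrite -ltr_ln ?posrE ?powR_gt0// ln_powR.
by nra.
Qed.

Lemma weighted_AMGM_lt v x y : 0 < v < 1 -> 0 <= x -> 0 <= y -> x != y ->
  x `^ v * y `^ (1 - v) < v * x + (1 - v) * y.
Proof.
move=> v01 x0 y0 xy; have /andP[v0 v1] := v01.
have [yE|yn0] := eqVneq y 0.
  rewrite yE in xy *; rewrite powR0 ?subr_eq0 ?gt_eqF// !mulr0 addr0 mulr_gt0//.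
  by rewrite lt_neqAle eq_sym xy.
have [xE|xn0] := eqVneq x 0.
  rewrite xE powR0 ?gt_eqF// mul0r mulr0 add0r mulr_gt0 ?subr_gt0//.
  by rewrite lt_neqAle eq_sym yn0.
have {}x0 : 0 < x by rewrite lt_neqAle eq_sym xn0.
have {}y0 : 0 < y by rewrite lt_neqAle eq_sym yn0.
have z1 : x / y != 1.
  apply: contra xy => /eqP /(congr1 ( *%R^~ y)).
  by rewrite divfK// mul1r => ->.
have := powR_lt_tangent v01 (divr_gt0 x0 y0) z1.
rewrite -(ltr_pM2r y0).
have -> : (x / y) `^ v * y = x `^ v * y `^ (1 - v).
  rewrite -[in RHS](divfK yn0 x) [in RHS]powRM ?divr_ge0 ?ltW//.
  by rewrite -[RHS]mulrA -powRD ?yn0 ?implybT// subrKC powRr1// ltW.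
suff -> : (1 + v * (x / y - 1)) * y = v * x + (1 - v) * y by [].
by field.
Qed.

Lemma weighted_AMGM v x y : 0 < v < 1 -> 0 <= x -> 0 <= y ->
  x `^ v * y `^ (1 - v) <= v * x + (1 - v) * y.
Proof.
move=> v01 x0 y0; have [<-|xy] := eqVneq x y; last first.
  exact/ltW/weighted_AMGM_lt.
rewrite -powRD ?subrKC ?oner_eq0// powRr1//.
lra.
Qed.

(** A lower bound agreeing with (1 + x)^p to first order at 0, where the tangent line itself only
    bounds from above. With z = 1 / (1 + x) and q = p (1 - z), AM-GM gives z^p <= 1 - q, and (1 + q)
    (1 - q) <= 1. *)
Lemma powR_ge_tangent p x : 0 < p < 1 -> -1 < x ->
  1 + p * (x / (1 + x)) <= (1 + x) `^ p.
Proof.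
move=> p01 x1; have /andP[p0 p1] := p01.
have x0 : 0 < 1 + x by lra.
set z := (1 + x)^-1; have z0 : 0 < z by rewrite invr_gt0.
have -> : x / (1 + x) = 1 - z by rewrite /z; field; exact: lt0r_neq0.
have -> : (1 + x) `^ p = (z `^ p)^-1.
  by rewrite -[1 + x]invrK -/z -powR_inv1 ?ltW// powRAC powR_inv1 ?powR_ge0.
have := weighted_AMGM p01 (ltW z0) ler01; rewrite powR1 !mulr1 => h.
rewrite -[leRHS]mul1r ler_pdivlMr ?powR_gt0//.
have zp0 := powR_ge0 z p.
have [k0|k0] := leP 0 (1 + p * (1 - z)); last by nra.
apply: (le_trans (ler_wpM2l k0 h)).
by have := sqr_ge0 (p * (1 - z)); lra.
Qed.
End powR_inequalities.

(** * The pointwise saddle inequality for the clipped pair *)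

Section pointwise.
Local Open Scope ring_scope.
Context (R : realType).
Implicit Types (a b c r s t u v x y z : R).

(** Weighted AM-GM at (x / r, y), scaled by r^v. By homogeneity, the right-hand side is the tangent
    plane of the affinity integrand along the whole ray x = r y. *)
Lemma affinity_tangent v r x y : 0 < v < 1 -> 0 < r -> 0 <= x -> 0 <= y ->
  x `^ v * y `^ (1 - v) <= r `^ v * (v / r * x + (1 - v) * y)
    ?= iff (x == r * y).
Proof.
move=> v01 r0 x0 y0.
have rn0 : r != 0 by rewrite gt_eqF.
have xr0 : 0 <= x / r by rewrite divr_ge0// ltW.
have -> : x `^ v * y `^ (1 - v) = r `^ v * ((x / r) `^ v * y `^ (1 - v)).
  by rewrite mulrA -powRM ?(ltW r0)// [r * _]mulrC divfK.
have -> : v / r * x = v * (x / r) by rewrite mulrAC mulrA.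
split; first by rewrite ler_pM2l ?powR_gt0//; exact: weighted_AMGM.
apply/eqP/eqP => [/mulfI|xE].
  rewrite gt_eqF ?powR_gt0// => /(_ isT) h; apply/eqP.
  have [<-|xy] := eqVneq (x / r) y; first by rewrite mulrC divfK.
  by have := weighted_AMGM_lt v01 xr0 y0 xy; rewrite h ltxx.
have -> : x / r = y by rewrite xE mulrC mulKf.
by rewrite -powRD ?subrKC ?oner_eq0// powRr1//; congr (_ * _); lra.
Qed.

(* The ratio [r] of the clipped pair lies in [[s, t]], and [x0] (resp. [x1])
   attains its upper bound where [s < r] (resp. [r < t]). Hence the tangent
   estimate of the affinity at (x0, x1) only grows when its slopes are replaced
   by [c0] and [c1], their values at the thresholds; with constant slopes, the
   linear terms cancel after integration. *)
Lemma clipped_saddle v s t a b y0 y1 : 0 < v < 1 -> 0 < s -> s < t ->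
  0 <= y0 <= a -> 0 <= y1 <= b ->
  let x0 := Num.min a (s^-1 * b) in let x1 := Num.min b (t * a) in
  let c0 := (1 - v) * s `^ v in let c1 := v * (t `^ v / t) in
  y1 `^ v * y0 `^ (1 - v) + (c0 * x0 + c1 * x1) <=
  x1 `^ v * x0 `^ (1 - v) + (c0 * y0 + c1 * y1)
    ?= iff ((y0 == x0) && (y1 == x1)).
Proof.
move=> v01 s0 st /andP[y00 y0a] /andP[y10 y1b] x0 x1 c0 c1.
have /andP[v0 v1] := v01.
have t0 : 0 < t by exact: lt_trans st.
have a0 : 0 <= a by exact: le_trans y0a.
have b0 : 0 <= b by exact: le_trans y1b.
have x00 : 0 <= x0 by rewrite le_min a0 mulr_ge0// invr_ge0 ltW.
have x10 : 0 <= x1 by rewrite le_min b0 mulr_ge0// ltW.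
(* The ratio [r] is b / a clamped to [s, t]. If a = b = 0 then x0 = x1 = 0 and any value in the
   interval serves; [s] is taken. *)
have [r [sr rt x1E x1b x0a]] : exists r, [/\ s <= r, r <= t, x1 = r * x0,
    r < t -> x1 = b & s < r -> x0 = a].
  have [bsa|sab] := ltP b (s * a).
    exists s; rewrite ltxx; split => //; [exact: ltW| |move=> _].
      have -> : x0 = s^-1 * b.
        by apply/min_idPr; rewrite mulrC ler_pdivrMr// mulrC ltW.
      rewrite mulVKf ?gt_eqF//; apply/min_idPl.
      by rewrite (le_trans (ltW bsa))// ler_wpM2r// ltW.
    by apply/min_idPl; rewrite (le_trans (ltW bsa))// ler_wpM2r// ltW.
  have x0a : x0 = a by apply/min_idPl; rewrite mulrC ler_pdivlMr// mulrC.
  have [tab|bta] := ltP (t * a) b.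
    exists t; rewrite ltxx x0a; split => //; first exact: ltW.
    by apply/min_idPr; exact: ltW.
  have x1b : x1 = b by exact/min_idPl.
  have [az|an0] := eqVneq a 0.
    have bz : b = 0.
      by apply/le_anti; rewrite b0 andbT (le_trans bta)// az mulr0.
    exists s; rewrite x0a x1b az bz mulr0; split => //; first exact: ltW.
  have {}a0 : 0 < a by rewrite lt_neqAle eq_sym an0.
  exists (b / a); rewrite x0a x1b divfK//; split => //.
    by rewrite ler_pdivlMr.
  by rewrite ler_pdivrMr.
have r0 : 0 < r by exact: lt_le_trans sr.
have [Ty Tyeq] := affinity_tangent v01 r0 y10 y00.
have {}Tx : x1 `^ v * x0 `^ (1 - v) = r `^ v * (v / r * x1 + (1 - v) * x0).
  by apply/eqP; rewrite (affinity_tangent v01 r0 x10 x00).2; apply/eqP.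
have e q : r `^ v * (v / r * q) = v * (r `^ v / r) * q by lra.
rewrite Tx mulrDr !e; rewrite mulrDr !e in Ty Tyeq.
set q := r `^ v / r in e Ty Tyeq *.
(* The slope in the second density decreases with the ratio, so its excess over [c1] is positive
   when r < t. There x1 = b bounds y1 from above. [h0] is the analogue for the first density, whose
   slope increases with the ratio. *)
have h1 : (v * q - c1) * (y1 - x1) <= 0 ?= iff ((r == t) || (y1 == x1)).
  have [rt'|rt'] := eqVneq r t.
    rewrite /q /c1 rt' subrr mul0r; split => //; exact/eqxx.
  have {}rt : r < t by rewrite lt_neqAle rt'.
  have -> : x1 = b by exact: x1b.
  have qc : 0 < v * q - c1.
    rewrite -mulrBr pmulr_rgt0// subr_gt0 /q.
    have V x : 0 < x -> x `^ v / x = (x `^ (1 - v))^-1.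
      move=> x_gt0; rewrite -{2}(powRr1 (ltW x_gt0)) -powRN.
      rewrite -powRD ?(gt_eqF x_gt0) ?implybT//.
      by rewrite -powRN opprB.
    rewrite !V// ltf_pV2 ?posrE ?powR_gt0//.
    by apply: gt0_ltr_powR; rewrite ?subr_gt0// nnegrE ltW.
  split; first by rewrite pmulr_rle0// subr_le0.
  by rewrite mulf_eq0 gt_eqF//= subr_eq0.
have h0 : ((1 - v) * r `^ v - c0) * (y0 - x0) <= 0
    ?= iff ((r == s) || (y0 == x0)).
  have [rs'|rs'] := eqVneq r s.
    by rewrite /c0 rs' subrr mul0r; split => //; exact/eqxx.
  have {}sr : s < r by rewrite lt_neqAle eq_sym rs'.
  have -> : x0 = a by exact: x0a.
  have qc : 0 < (1 - v) * r `^ v - c0.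
    rewrite -mulrBr pmulr_rgt0 ?subr_gt0//.
    by apply: gt0_ltr_powR; rewrite // nnegrE ltW.
  split; first by rewrite pmulr_rle0// subr_le0.
  by rewrite mulf_eq0 gt_eqF//= subr_eq0.
have [h1l h1e] := h1; have [h0l h0e] := h0.
split; first by lra.
apply/eqP/andP => [E|[/eqP y0x /eqP y1x]]; last first.
  by rewrite y0x y1x Tx mulrDr e; lra.
have E1 : (r == t) || (y1 == x1).
  by rewrite -h1e; apply/eqP/le_anti/andP; split => //; lra.
have E0 : (r == s) || (y0 == x0).
  by rewrite -h0e; apply/eqP/le_anti/andP; split => //; lra.
have y1r : y1 == r * y0.
  by rewrite -Tyeq; apply/eqP/le_anti/andP; split => //; lra.
have [y0x|y0x] := eqVneq y0 x0.
  by split => //; rewrite (eqP y1r) y0x x1E.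
(* If y0 differs from x0, then r = s < t, so y1 = x1. Both pairs lie on the ray of slope [r], which
   forces y0 = x0. *)
move: E0; rewrite (negbTE y0x) orbF => /eqP rs.
move: E1; rewrite rs lt_eqF//= => /eqP y1x.
move: y1r; rewrite y1x x1E => /eqP/mulfI; rewrite gt_eqF// => /(_ isT) y0E.
by rewrite y0E eqxx in y0x.
Qed.

End pointwise.

(** * Integrals of non-negative real functions *)

Section nonnegative_integrals.
Context d (T : measurableType d) (R : realType).
Variable mu : {measure set T -> \bar R}.
Implicit Types f g h : T -> R.

Definition nneg_measurable f :=
  measurable_fun setT f /\ forall w, (0 <= f w)%R.

Lemma nneg_integralD f g : nneg_measurable f -> nneg_measurable g ->
  \int[mu]_w (f w + g w)%:E = \int[mu]_w (f w)%:E + \int[mu]_w (g w)%:E.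
Proof.
move=> [mf f0] [mg g0]; under eq_integral do rewrite EFinD.
by rewrite ge0_integralD// => [w _||w _|];
  rewrite ?lee_fin//; exact/measurable_EFinP.
Qed.

Lemma nneg_integralZ k f : (0 <= k)%R -> nneg_measurable f ->
  \int[mu]_w (k * f w)%:E = k%:E * \int[mu]_w (f w)%:E.
Proof.
move=> k0 [mf f0]; under eq_integral do rewrite EFinM.
by rewrite ge0_integralZl_EFin// => [w _|];
  rewrite ?lee_fin//; exact/measurable_EFinP.
Qed.

Lemma nneg_ae_le_integral f g : nneg_measurable f -> nneg_measurable g ->
  {ae mu, forall w, (f w <= g w)%R} ->
  \int[mu]_w (f w)%:E <= \int[mu]_w (g w)%:E.
Proof.
move=> [mf f0] [mg g0] fg; apply: ae_ge0_le_integral => // [w _||w _||].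
- by rewrite lee_fin.
- exact/measurable_EFinP.
- by rewrite lee_fin.
- exact/measurable_EFinP.
- by apply: filterS fg => w fgw _; rewrite lee_fin.
Qed.

Lemma nneg_ae_eq_integral f g : nneg_measurable f -> nneg_measurable g ->
  {ae mu, forall w, f w = g w} ->
  \int[mu]_w (f w)%:E = \int[mu]_w (g w)%:E.
Proof.
move=> mf mg fg; apply/le_anti/andP; split; apply: nneg_ae_le_integral => //;
  by apply: filterS fg => w ->.
Qed.

Lemma nneg_integral_eq0 f : nneg_measurable f -> \int[mu]_w (f w)%:E = 0 ->
  {ae mu, forall w, f w = 0%R}.
Proof.
move=> [mf f0] If; have mfE : measurable_fun setT (EFin \o f).
  exact/measurable_EFinP.
have [h _] := @ae_eq_integral_abs _ _ _ mu setT measurableT (EFin \o f) mfE.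
have : ae_eq mu setT (EFin \o f) (cst 0).
  apply: h; rewrite -[RHS]If; apply: eq_integral => w _ /=.
  by rewrite ger0_norm.
by apply: filterS => w /(_ I) /= [].
Qed.

(** The positive part [h] of g - f is non-negative everywhere and satisfies f + h = g almost
    everywhere. Cancelling the finite integral of f shows that [h] has integral 0. *)
Lemma nneg_ae_le_integral_eq f g : nneg_measurable f -> nneg_measurable g ->
  {ae mu, forall w, (f w <= g w)%R} ->
  \int[mu]_w (g w)%:E <= \int[mu]_w (f w)%:E ->
  \int[mu]_w (f w)%:E < +oo -> {ae mu, forall w, f w = g w}.
Proof.
move=> mf mg fg gf fin; have [mf' f0] := mf; have [mg' g0] := mg.
pose h := (fun w => Num.max 0 (g w - f w))%R.
have mh : nneg_measurable h.
  split=> [|w]; last by rewrite le_max lexx.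
  apply: measurable_maxr => //; exact: measurable_funB.
have hE : {ae mu, forall w, f w + h w = g w}%R.
  by apply: filterS fg => w fgw; rewrite /h max_r ?subr_ge0// subrKC.
have mfh : nneg_measurable (fun w => f w + h w)%R.
  split=> [|w]; first by case: mh => mh' _; exact: measurable_funD.
  by rewrite addr_ge0//; case: mh.
have fin' : \int[mu]_w (f w)%:E \is a fin_num.
  by rewrite ge0_fin_numE// integral_ge0// => w _; rewrite lee_fin.
have h0 : \int[mu]_w (h w)%:E = 0.
  apply/le_anti/andP; split; last first.
    by apply: integral_ge0 => w _; rewrite lee_fin; case: mh.
  rewrite -(@leeD2lE _ _ _ _ fin') adde0 -nneg_integralD//.
  by rewrite (nneg_ae_eq_integral mfh mg hE).
move/(nneg_integral_eq0 mh): h0; apply: filterS2 hE => w <- ->.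
by rewrite addr0.
Qed.

End nonnegative_integrals.

(** * Extended density ratios, and clipping as a minimum *)

Section density_ratio.
Context (T : Type) (R : realType).
Implicit Types (f g : T -> R) (t : R) (w : T).

Lemma density_ratioE g f w : (0 <= g w)%R ->
  density_ratio g f w =
  if f w == 0%R then (if g w == 0%R then 0 else +oo) else (g w / f w)%:E.
Proof.
move=> g0; rewrite /density_ratio inver; case: ifPn => // _.
have [->|gn0] := eqVneq (g w) 0%R; first by rewrite mul0e.
by rewrite gt0_muley// lte_fin lt_def gn0.
Qed.

Lemma density_ratio_eq_fin t g f w : (0 < t)%R -> (0 <= g w)%R ->
  density_ratio g f w = t%:E -> f w != 0%R /\ g w = (t * f w)%R.
Proof.
move=> t0 g0; rewrite density_ratioE//; case: (eqVneq (f w) 0%R) => [_|fn0].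
  by case: ifPn => // _ [] te; rewrite -te ltxx in t0.
by move=> [<-]; rewrite divfK.
Qed.

(** The second conjunct excludes 0 / 0: there t f <= g holds, but the ratio has the value 0 < t. *)
Lemma le_density_ratio t g f w : (0 < t)%R -> (0 <= g w)%R -> (0 <= f w)%R ->
  (t%:E <= density_ratio g f w) = (t * f w <= g w)%R && (0 < f w + g w)%R.
Proof.
move=> t0 g0 f0; rewrite density_ratioE//.
have [->|fn0] := eqVneq (f w) 0%R.
  rewrite mulr0 g0 add0r; have [->|gn0] := eqVneq (g w) 0%R.
    by rewrite lee_fin leNgt t0 ltxx.
  by rewrite /= leey lt_def gn0 g0.
have {}f0 : (0 < f w)%R by rewrite lt_def fn0.
by rewrite lee_fin ler_pdivlMr// ltr_wpDr// andbT.
Qed.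

Lemma density_ratio_le t g f w : (0 < t)%R -> (0 <= g w)%R -> (0 <= f w)%R ->
  (density_ratio g f w <= t%:E) = (g w <= t * f w)%R.
Proof.
move=> t0 g0 f0; rewrite density_ratioE//.
have [->|fn0] := eqVneq (f w) 0%R.
  rewrite mulr0; have [->|gn0] := eqVneq (g w) 0%R.
    by rewrite lee_fin ltW// lexx.
  by rewrite leye_eq/= leNgt lt_def gn0 g0.
have {}f0 : (0 < f w)%R by rewrite lt_def fn0.
by rewrite lee_fin ler_pdivrMr.
Qed.

(** At a 0 / 0 point the definition takes its second branch, but both terms of the minimum vanish
    there. The minimum makes bounds, measurability and the symmetry between the classes
    accessible. *)
Lemma clipped0E f g t w : (0 < t)%R -> (0 <= f w)%R -> (0 <= g w)%R ->
  clipped0 f g t w = Num.min (f w) (t^-1 * g w)%R.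
Proof.
move=> t0 f0 g0; rewrite /clipped0 le_density_ratio//; apply/esym.
rewrite mulrC; case: ifPn => [/andP[h _]|].
  by apply/min_idPl; rewrite ler_pdivlMr// mulrC.
rewrite negb_and -ltNge -leNgt => /orP[h|h].
  by apply/min_idPr; rewrite ler_pdivrMr// mulrC ltW.
have fz : f w = 0%R by lra.
have gz : g w = 0%R by lra.
by rewrite fz gz mul0r minxx.
Qed.

Lemma clipped1E f g t w : (0 < t)%R -> (0 <= f w)%R -> (0 <= g w)%R ->
  clipped1 f g t w = Num.min (g w) (t * f w)%R.
Proof.
move=> t0 f0 g0; rewrite /clipped1 density_ratio_le//; apply/esym.
case: ifPn => [h|]; first exact/min_idPl.
by rewrite -ltNge => /ltW h; exact/min_idPr.
Qed.

End density_ratio.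

(** * Measurability, normalization, and elements of a band *)

Section bands.
Context d (T : measurableType d) (R : realType).
Variable mu : {measure set T -> \bar R}.
Implicit Types (f g h : T -> R) (u t : R).

Lemma nneg_measurableZ k f : (0 <= k)%R -> nneg_measurable f ->
  nneg_measurable (fun w => k * f w)%R.
Proof.
move=> k0 [mf f0]; split=> [|w]; last by rewrite mulr_ge0.
by apply: measurable_funM => //; exact: measurable_cst.
Qed.

Lemma nneg_measurableD f g : nneg_measurable f -> nneg_measurable g ->
  nneg_measurable (fun w => f w + g w)%R.
Proof.
move=> [mf f0] [mg g0]; split=> [|w]; last by rewrite addr_ge0.
exact: measurable_funD.
Qed.

Lemma nneg_measurable_min f g : nneg_measurable f -> nneg_measurable g ->
  nneg_measurable (fun w => Num.min (f w) (g w)).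
Proof.
move=> [mf f0] [mg g0]; split=> [|w]; last by rewrite le_min f0 g0.
exact: measurable_minr.
Qed.

Lemma nneg_measurable_if (b : T -> bool) f g : measurable_fun setT b ->
  nneg_measurable f -> nneg_measurable g ->
  nneg_measurable (fun w => if b w then f w else g w).
Proof.
move=> mb [mf f0] [mg g0]; split=> [|w]; last by case: ifP.
exact: measurable_fun_ifT.
Qed.

Lemma nneg_measurable_affinity u f g :
  measurable_fun setT f -> measurable_fun setT g ->
  nneg_measurable (fun w => g w `^ u * f w `^ (1 - u))%R.
Proof.
move=> mf mg; split=> [|w]; last by rewrite mulr_ge0 ?powR_ge0.
by apply: measurable_funM; apply: (measurableT_comp (measurable_powR _)).
Qed.

Lemma integral_if (b : T -> bool) k f g : (0 <= k)%R ->
  measurable_fun setT b -> nneg_measurable f -> nneg_measurable g ->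
  \int[mu]_w (if b w then f w else (k * g w)%R)%:E =
  \int[mu]_(w in [set w | b w]) (f w)%:E +
  k%:E * \int[mu]_(w in [set w | ~~ b w]) (g w)%:E.
Proof.
move=> k0 mb mf mg; rewrite (integral_mkcond [set w | b w]).
rewrite (integral_mkcond [set w | ~~ b w]).
have inb (P : pred T) w : (w \in [set w | P w]) = P w.
  by apply/idP/idP; rewrite inE.
have z : nneg_measurable ((fun=> 0) : T -> R)%R by split.
have -> : (fun w => (f w)%:E) \_ [set w | b w] =
    (fun w => (if b w then f w else 0%R)%:E).
  by apply/funext => w; rewrite patchE inb; case: ifP.
have -> : (fun w => (g w)%:E) \_ [set w | ~~ b w] =
    (fun w => (if b w then 0%R else g w)%:E).
  by apply/funext => w; rewrite patchE (inb (fun w => ~~ b w)); case: (b w).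
have mf' := nneg_measurable_if mb mf z.
have mg' := nneg_measurable_if mb z mg.
rewrite -nneg_integralZ// -nneg_integralD//; last exact: nneg_measurableZ.
apply: eq_integral => w _.
by case: (b w); rewrite ?mulr0 ?addr0 ?add0r.
Qed.

Lemma nneg_measurable_clipped0 f g t : (0 < t)%R ->
  nneg_measurable f -> nneg_measurable g ->
  nneg_measurable (clipped0 f g t).
Proof.
move=> t0 mf mg.
have -> : clipped0 f g t = (fun w => Num.min (f w) (t^-1 * g w))%R.
  by apply/funext => w; rewrite clipped0E//; [case: mf|case: mg].
apply: nneg_measurable_min => //.
by apply: nneg_measurableZ => //; rewrite invr_ge0 ltW.
Qed.

Lemma nneg_measurable_clipped1 f g t : (0 < t)%R ->
  nneg_measurable f -> nneg_measurable g ->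
  nneg_measurable (clipped1 f g t).
Proof.
move=> t0 mf mg.
have -> : clipped1 f g t = (fun w => Num.min (g w) (t * f w))%R.
  by apply/funext => w; rewrite clipped1E//; [case: mf|case: mg].
apply: nneg_measurable_min => //.
by apply: nneg_measurableZ => //; exact: ltW.
Qed.

Lemma normalization0E f g t : (0 < t)%R ->
  nneg_measurable f -> nneg_measurable g ->
  normalization0 mu f g t = (\int[mu]_w (clipped0 f g t w)%:E = 1).
Proof.
move=> t0 mf mg; have [[mf' f0] [mg' g0]] := (mf, mg).
rewrite /normalization0; congr (_ = _).
have -> : [set w | density_ratio g f w < t%:E] =
    [set w | ~~ (t%:E <= density_ratio g f w)].
  by apply/seteqP; split=> w /=; rewrite ltNge.
rewrite -integral_if//; first by rewrite invr_ge0 ltW.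
under eq_fun do rewrite le_density_ratio//.
apply: measurable_and; first apply: measurable_fun_ler => //.
  by apply: measurable_funM => //; exact: measurable_cst.
by apply: measurable_fun_ltr => //; exact: measurable_funD.
Qed.

Lemma normalization1E f g t : (0 < t)%R ->
  nneg_measurable f -> nneg_measurable g ->
  normalization1 mu f g t = (\int[mu]_w (clipped1 f g t w)%:E = 1).
Proof.
move=> t0 mf mg; have [[mf' f0] [mg' g0]] := (mf, mg).
rewrite /normalization1; congr (_ = _).
have -> : [set w | t%:E < density_ratio g f w] =
    [set w | ~~ (density_ratio g f w <= t%:E)].
  by apply/seteqP; split=> w /=; rewrite ltNge.
rewrite -integral_if//; first exact: ltW.
under eq_fun do rewrite density_ratio_le//.
apply: measurable_fun_ler => //.
by apply: measurable_funM => //; exact: measurable_cst.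
Qed.

(** Clamping [g] into [0, f] changes it only on a null set. The pointwise inequalities then apply
    without exceptional points. *)
Lemma band_truncated f g : nneg_measurable f -> band mu f g ->
  exists g', [/\ band mu f g', forall w, (0 <= g' w <= f w)%R &
                 {ae mu, forall w, g w = g' w}].
Proof.
move=> [mf f0] [mg g0f Ig].
pose g' w := Num.max 0%R (Num.min (f w) (g w)).
have g'b w : (0 <= g' w <= f w)%R.
  by rewrite le_max lexx/= ge_max f0 ge_min lexx.
have gE : {ae mu, forall w, g w = g' w}.
  apply: filterS g0f => w /andP[g0 gf].
  by rewrite /g' (min_idPr gf) (max_idPr g0).
have mg' : measurable_fun setT g'.
  by apply: measurable_maxr; [exact: measurable_cst|exact: measurable_minr].
exists g'; split => //; split => //; first exact: aeW.
rewrite -Ig; apply: ae_eq_integral => //.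
- exact/measurable_EFinP.
- exact/measurable_EFinP.
- by apply: filterS gE => w -> _.
Qed.

Lemma affinity_ae_eq u f f' g g' :
  measurable_fun setT f -> measurable_fun setT f' ->
  measurable_fun setT g -> measurable_fun setT g' ->
  {ae mu, forall w, f w = f' w} -> {ae mu, forall w, g w = g' w} ->
  affinity mu u f g = affinity mu u f' g'.
Proof.
move=> mf mf' mg mg' ff gg; apply: nneg_ae_eq_integral.
- exact: nneg_measurable_affinity.
- exact: nneg_measurable_affinity.
- by apply: filterS2 ff gg => w -> ->.
Qed.

Lemma affinityC u f g : affinity mu u f g = affinity mu (1 - u) g f.
Proof.
by apply: eq_integral => w _; rewrite mulrC; congr (_ * _ `^ _)%:E; lra.
Qed.

Lemma affinity_lty u f g : (0 < u < 1)%R ->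
  nneg_measurable f -> nneg_measurable g ->
  \int[mu]_w (f w)%:E = 1 -> \int[mu]_w (g w)%:E = 1 ->
  affinity mu u f g < +oo.
Proof.
move=> u01 mf mg If Ig; have /andP[u0 u1] := u01.
have mf' : nneg_measurable (fun w => (1 - u) * f w)%R.
  by apply: nneg_measurableZ => //; rewrite subr_ge0 ltW.
have mg' : nneg_measurable (fun w => u * g w)%R.
  by apply: nneg_measurableZ => //; exact: ltW.
apply: (@le_lt_trans _ _ (\int[mu]_w (u * g w + (1 - u) * f w)%:E)).
  apply: nneg_ae_le_integral.
  - by apply: nneg_measurable_affinity; [case: mf|case: mg].
  - exact: nneg_measurableD.
  - by apply: aeW => w; apply: weighted_AMGM => //; [case: mg|case: mf].
rewrite nneg_integralD// !nneg_integralZ// ?subr_ge0 ?ltW//.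
by rewrite If Ig -!EFinM -EFinD ltry.
Qed.

End bands.

(** * The clipped pair as unique maximizer of every affinity *)

Section clipped_densities_maximality.
Context d (T : measurableType d) (R : realType).
Variable mu : {measure set T -> \bar R}.
Variables gU0 gU1 : T -> R.
Hypotheses (mgU0 : nneg_measurable gU0) (mgU1 : nneg_measurable gU1).
Implicit Types (f g h : T -> R) (s t v : R).

Lemma clipped0_bounds t w : (0 < t)%R ->
  (0 <= clipped0 gU0 gU1 t w <= gU0 w)%R.
Proof.
move=> t0; have [[_ f0] [_ g0]] := (mgU0, mgU1).
by rewrite clipped0E// le_min f0 ge_min lexx mulr_ge0// invr_ge0 ltW.
Qed.

Lemma clipped1_bounds t w : (0 < t)%R ->
  (0 <= clipped1 gU0 gU1 t w <= gU1 w)%R.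
Proof.
move=> t0; have [[_ f0] [_ g0]] := (mgU0, mgU1).
by rewrite clipped1E// le_min g0 ge_min lexx mulr_ge0// ltW.
Qed.

Lemma clipped0_band t : (0 < t)%R ->
  \int[mu]_w (clipped0 gU0 gU1 t w)%:E = 1 ->
  band mu gU0 (clipped0 gU0 gU1 t).
Proof.
move=> t0 It; have [mc _] := nneg_measurable_clipped0 t0 mgU0 mgU1.
split => //.
by apply: aeW => w; exact: clipped0_bounds.
Qed.

Lemma clipped1_band t : (0 < t)%R ->
  \int[mu]_w (clipped1 gU0 gU1 t w)%:E = 1 ->
  band mu gU1 (clipped1 gU0 gU1 t).
Proof.
move=> t0 It; have [mc _] := nneg_measurable_clipped1 t0 mgU0 mgU1.
split => //.
by apply: aeW => w; exact: clipped1_bounds.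
Qed.

Lemma normalized_lower_lt1 t : (0 < t)%R ->
  band mu gU0 `&` band mu gU1 = set0 ->
  \int[mu]_w (clipped0 gU0 gU1 t w)%:E = 1 -> (t < 1)%R.
Proof.
move=> t0 disj It; rewrite ltNge; apply/negP => t1.
suff : (band mu gU0 `&` band mu gU1) (clipped0 gU0 gU1 t) by rewrite disj.
have [m0 b0 _] := clipped0_band t0 It.
split; first exact: clipped0_band.
split => //; apply: aeW => w; have [[_ f0] [_ g0]] := (mgU0, mgU1).
have /andP[-> _] := clipped0_bounds w t0.
rewrite clipped0E//= ge_min; apply/orP; right.
by rewrite -[leRHS]mul1r ler_wpM2r// invf_le1.
Qed.

Lemma normalized_upper_gt1 t : (0 < t)%R ->
  band mu gU0 `&` band mu gU1 = set0 ->
  \int[mu]_w (clipped1 gU0 gU1 t w)%:E = 1 -> (1 < t)%R.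
Proof.
move=> t0 disj It; rewrite ltNge; apply/negP => t1.
suff : (band mu gU0 `&` band mu gU1) (clipped1 gU0 gU1 t) by rewrite disj.
have [m0 b0 _] := clipped1_band t0 It.
split; last exact: clipped1_band.
split => //; apply: aeW => w; have [[_ f0] [_ g0]] := (mgU0, mgU1).
have /andP[-> _] := clipped1_bounds w t0.
rewrite clipped1E//= ge_min; apply/orP; right.
by rewrite -[leRHS]mul1r ler_wpM2r.
Qed.

Section fixed_thresholds.
Variables s t : R.
Hypotheses (s_gt0 : (0 < s)%R) (s_lt_t : (s < t)%R).
Hypothesis I0 : \int[mu]_w (clipped0 gU0 gU1 s w)%:E = 1.
Hypothesis I1 : \int[mu]_w (clipped1 gU0 gU1 t w)%:E = 1.

Let t_gt0 : (0 < t)%R. Proof. exact: lt_trans s_lt_t. Qed.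

Lemma clipped_affinity_max v h0 h1 : (0 < v < 1)%R ->
  band mu gU0 h0 -> band mu gU1 h1 ->
  affinity mu v h0 h1 <=
    affinity mu v (clipped0 gU0 gU1 s) (clipped1 gU0 gU1 t) /\
  (affinity mu v (clipped0 gU0 gU1 s) (clipped1 gU0 gU1 t) <=
    affinity mu v h0 h1 ->
   {ae mu, forall w, h0 w = clipped0 gU0 gU1 s w /\
                     h1 w = clipped1 gU0 gU1 t w}).
Proof.
move=> v01 bh0 bh1; have /andP[v0 v1] := v01.
have [y0 [[my0 _ Iy0] y0b h0y]] := band_truncated mgU0 bh0.
have [y1 [[my1 _ Iy1] y1b h1y]] := band_truncated mgU1 bh1.
rewrite (affinity_ae_eq v _ my0 _ my1 h0y h1y); [|by case: bh0|by case: bh1].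
set x0 := clipped0 _ _ _; set x1 := clipped1 _ _ _.
have mx0 : nneg_measurable x0 by exact: nneg_measurable_clipped0.
have mx1 : nneg_measurable x1 by exact: nneg_measurable_clipped1.
have {}my0 : nneg_measurable y0 by split=> // w; case/andP: (y0b w).
have {}my1 : nneg_measurable y1 by split=> // w; case/andP: (y1b w).
pose c0 : R := ((1 - v) * s `^ v)%R; pose c1 : R := (v * (t `^ v / t))%R.
have c0_ge0 : (0 <= c0)%R by rewrite mulr_ge0 ?powR_ge0// subr_ge0 ltW.
have c1_ge0 : (0 <= c1)%R.
  by apply: mulr_ge0; [exact: ltW|rewrite divr_ge0 ?powR_ge0// ltW].
have mA := nneg_measurable_affinity v.
(* [F] and [G] are the two sides of [clipped_saddle]. All four densities have mass 1, so both linear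
   terms integrate to c0 + c1 and cancel. *)
pose F w := (y1 w `^ v * y0 w `^ (1 - v) + (c0 * x0 w + c1 * x1 w))%R.
pose G w := (x1 w `^ v * x0 w `^ (1 - v) + (c0 * y0 w + c1 * y1 w))%R.
have [[mx0' _] [mx1' _]] := (mx0, mx1).
have [[my0' _] [my1' _]] := (my0, my1).
have Lm f g : nneg_measurable f -> nneg_measurable g ->
    nneg_measurable (fun w => c0 * f w + c1 * g w)%R.
  by move=> mf mg; apply: nneg_measurableD; exact: nneg_measurableZ.
have L f g : nneg_measurable f -> nneg_measurable g ->
    \int[mu]_w (f w)%:E = 1 -> \int[mu]_w (g w)%:E = 1 ->
    \int[mu]_w (c0 * f w + c1 * g w)%:E = (c0 + c1)%:E.
  move=> mf mg If Ig; rewrite nneg_integralD; try exact: nneg_measurableZ.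
  by rewrite !nneg_integralZ// If Ig !mule1.
have mF : nneg_measurable F.
  by apply: nneg_measurableD; [exact: mA|exact: Lm].
have mG : nneg_measurable G.
  by apply: nneg_measurableD; [exact: mA|exact: Lm].
have IF : \int[mu]_w (F w)%:E = affinity mu v y0 y1 + (c0 + c1)%:E.
  by rewrite nneg_integralD ?L//; [exact: mA|exact: Lm].
have IG : \int[mu]_w (G w)%:E = affinity mu v x0 x1 + (c0 + c1)%:E.
  by rewrite nneg_integralD ?L//; [exact: mA|exact: Lm].
have FG w : (F w <= G w ?= iff ((y0 w == x0 w) && (y1 w == x1 w)))%R.
  have [[_ f0] [_ g0]] := (mgU0, mgU1).
  rewrite /F /G /x0 /x1 clipped0E// clipped1E//.
  exact: clipped_saddle.
have FGle : {ae mu, forall w, (F w <= G w)%R} by apply: aeW => w; apply: (FG w).1.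
have := nneg_ae_le_integral mF mG FGle.
rewrite IF IG leeD2rE// => le_xy; split => // xy_le.
(* Equality of integrals forces F = G almost everywhere because the affinity is finite; the equality
   case of [clipped_saddle] then identifies the densities. *)
have : {ae mu, forall w, F w = G w}.
  apply: nneg_ae_le_integral_eq => //; first by rewrite IF IG leeD2rE.
  rewrite IF lte_add_pinfty ?ltry//.
  exact: affinity_lty.
move=> FeqG; apply: filterS3 FeqG h0y h1y => w FGw -> ->.
by move/eqP: FGw; rewrite (FG w).2 => /andP[/eqP -> /eqP ->].
Qed.

Lemma clipped_max_affinity v : (0 < v < 1)%R ->
  max_affinity mu gU0 gU1 v =
  affinity mu v (clipped0 gU0 gU1 s) (clipped1 gU0 gU1 t).
Proof.
move=> v01; apply/le_anti/andP; split.
  apply: ge_ereal_sup => _ [[h0 h1] [/= bh0 bh1] <-].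
  by have [] := clipped_affinity_max v01 bh0 bh1.
apply: ereal_sup_ubound; exists (clipped0 gU0 gU1 s, clipped1 gU0 gU1 t) => //=.
by split; [exact: clipped0_band|exact: clipped1_band].
Qed.

(** The given least favorable pair supplies the minimizing [u]; the clipped pair attains the maximum
    at that [u], as at every other. *)
Lemma least_favorable_clipped h0 h1 : least_favorable mu gU0 gU1 h0 h1 ->
  least_favorable mu gU0 gU1 (clipped0 gU0 gU1 s) (clipped1 gU0 gU1 t).
Proof.
move=> [bh0 bh1 [u [u01 umin _]]].
split; [exact: clipped0_band|exact: clipped1_band|].
by exists u; split => //; rewrite clipped_max_affinity.
Qed.

Lemma least_favorable_unique h0 h1 : least_favorable mu gU0 gU1 h0 h1 ->
  {ae mu, forall w, h0 w = clipped0 gU0 gU1 s w /\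
                    h1 w = clipped1 gU0 gU1 t w}.
Proof.
move=> [bh0 bh1 [u [u01 _]]]; rewrite clipped_max_affinity// => hE.
by have [_] := clipped_affinity_max u01 bh0 bh1; apply; rewrite hE.
Qed.

End fixed_thresholds.
End clipped_densities_maximality.

(** * Exchange of mass within one density *)

Section exchange.
Context (R : realType).
Implicit Types u t k b x y z : R.

(** Here x and y are values of g0 and g1, b z is the mass added and k x the mass removed. Since z >
    0 forces y = t x, no point both gains and loses, and [powR_ge_tangent] treats each case. With z
    <= x, the gain is bounded by a term linear in z, ready for integration. *)
Lemma affinity_exchange_ge u t k b x y z : (0 < u < 1 -> 0 < t ->
  0 <= k < 1 -> 0 <= b -> 0 <= x -> 0 <= y -> 0 <= z <= x ->
  (0 < z -> y = t * x) ->
  y `^ u * x `^ (1 - u) + t `^ u * (1 - u) * (b / (1 + b)) * z <=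
  y `^ u * (x + b * z - k * (if y < t * x then x else 0)) `^ (1 - u) +
  (1 - u) * (k / (1 - k)) * (if y < t * x then y `^ u * x `^ (1 - u) else 0))%R.
Proof.
move=> u01 t0 /andP[k0 k1] b0 x0 y0 /andP[z0 zx] zy.
have /andP[u0 u1] := u01.
have p01 : (0 < 1 - u < 1)%R by lra.
case: ifPn => [yx|_].
  have -> : z = 0%R.
    apply/eqP; rewrite eq_le z0 andbT leNgt; apply/negP => /zy yE.
    by rewrite yE ltxx in yx.
  have -> : (x + b * 0 - k * x = x * (1 + - k))%R by lra.
  rewrite powRM//; last by lra.
  have k1' : (-1 < - k)%R by lra.
  have h := powR_ge_tangent p01 k1'.
  have G0 : (0 <= y `^ u * x `^ (1 - u))%R by rewrite mulr_ge0 ?powR_ge0.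
  have := ler_wpM2l G0 h; have -> : (- k / (1 - k) = - (k / (1 - k)))%R by rewrite mulNr.
  by rewrite mulrA; lra.
rewrite !mulr0 subr0 addr0.
have [zE|zn0] := eqVneq z 0%R; first by rewrite zE !mulr0 !addr0.
have {zn0}z_gt0 : (0 < z)%R by rewrite lt_def zn0.
have x_gt0 : (0 < x)%R by exact: lt_le_trans zx.
have xn0 : x != 0%R by rewrite gt_eqF.
have -> : (x + b * z = x * (1 + b * (z / x)))%R by field.
set s := (z / x)%R.
have s0 : (0 <= s)%R by rewrite divr_ge0.
have s1 : (s <= 1)%R by rewrite ler_pdivrMr// mul1r.
have bs : (0 <= b * s)%R by exact: mulr_ge0.
have bs1 : (-1 < b * s)%R by lra.
rewrite powRM//; last by lra.
have h := powR_ge_tangent p01 bs1.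
have yxE : (y `^ u * x `^ (1 - u) = t `^ u * x)%R.
  rewrite zy// powRM// ?ltW// -mulrA -powRD ?subrKC ?oner_eq0//.
  by rewrite powRr1.
have h2 : (b / (1 + b) * s <= b * s / (1 + b * s))%R.
  rewrite mulrAC ler_wpM2l// lef_pV2 ?posrE; try lra.
  by rewrite lerD2l ler_piMr.
have zE : (z = s * x)%R by rewrite /s divfK.
rewrite [leRHS]mulrA yxE zE; clearbody s.
have tx0 : (0 <= t `^ u * x)%R by rewrite mulr_ge0 ?powR_ge0.
have h3 : ((1 - u) * (b / (1 + b) * s) <= (1 - u) * (b * s / (1 + b * s)))%R.
  by rewrite ler_wpM2l//; lra.
by have := ler_wpM2l tx0 h; have := ler_wpM2l tx0 h3; lra.
Qed.

Context d (T : measurableType d).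
Variable mu : {measure set T -> \bar R}.

(* Otherwise, moving mass of [g0] from [{g1 < t * g0}], where the affinity has
   slope less than [(1 - u) * t `^ u] in [g0], to [{0 < g0 < gU}], where the
   slope is exactly that, would increase the affinity. *)
Lemma affinity_max_exchange u t (gU g0 g1 : T -> R) : (0 < u < 1)%R ->
  (0 < t)%R -> nneg_measurable gU -> nneg_measurable g0 ->
  nneg_measurable g1 -> (forall w, (g0 w <= gU w)%R) ->
  \int[mu]_w (g0 w)%:E = 1 -> \int[mu]_w (g1 w)%:E = 1 ->
  (forall h, band mu gU h -> affinity mu u h g1 <= affinity mu u g0 g1) ->
  {ae mu, forall w, (0 < g0 w < gU w)%R -> g1 w = (t * g0 w)%R} ->
  {ae mu, forall w, g0 w = 0%R \/ g0 w = gU w} \/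
  {ae mu, forall w, (t * g0 w <= g1 w)%R}.
Proof.
move=> u01 t0 mgU mg0 mg1 g0U I0 I1 gmax stat.
have /andP[u0 u1] := u01.
have [[mU U0] [m0 g00] [m1 g10]] := And3 mgU mg0 mg1.
have mz : nneg_measurable ((fun=> 0%R) : T -> R) by split.
have m_lt : measurable_fun setT (fun w => g1 w < t * g0 w)%R.
  apply: measurable_fun_ltr => //.
  by apply: measurable_funM => //; exact: measurable_cst.
(* [phi] is positive exactly where 0 < g0 < gU and measures the room for added mass; [psi] is the
   mass available on {g1 < t * g0}, and [chi] the affinity integrand there. *)
pose phi w := Num.min (g0 w) (gU w - g0 w)%R.
pose psi w : R := if (g1 w < t * g0 w)%R then g0 w else 0%R.
pose G w := (g1 w `^ u * g0 w `^ (1 - u))%R.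
pose chi w : R := if (g1 w < t * g0 w)%R then G w else 0%R.
have phib w : (0 <= phi w <= g0 w)%R.
  by rewrite le_min g00 subr_ge0 g0U ge_min lexx.
have mphi : nneg_measurable phi.
  split=> [|w]; last by case/andP: (phib w).
  by apply: measurable_minr => //; exact: measurable_funB.
have mpsi : nneg_measurable psi by exact: nneg_measurable_if.
have mG : nneg_measurable G by exact: nneg_measurable_affinity.
have mchi : nneg_measurable chi by exact: nneg_measurable_if.
have psib w : (0 <= psi w <= g0 w)%R by rewrite /psi; case: ifP; rewrite lexx g00.
have chi_le w : (chi w <= t `^ u * psi w)%R.
  rewrite /chi /psi /G; case: ifP => [yx|_]; last by rewrite mulr0.
  have tg0 : (0 <= t * g0 w)%R by exact: le_trans (g10 w) (ltW yx).
  have : (g1 w `^ u <= t `^ u * g0 w `^ u)%R.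
    rewrite -powRM ?(ltW t0)//.
    by apply: ge0_ler_powR; rewrite ?nnegrE ?(ltW u0)// ltW.
  move/(ler_wpM2r (powR_ge0 (g0 w) (1 - u))); rewrite -mulrA -powRD.
    by rewrite subrKC powRr1.
  by rewrite subrKC oner_eq0.
have real_int f : nneg_measurable f -> \int[mu]_w (f w)%:E < +oo ->
    exists r : R, (0 <= r)%R /\ \int[mu]_w (f w)%:E = r%:E.
  move=> [mf f0] fin; exists (fine (\int[mu]_w (f w)%:E)).
  have f0' : 0 <= \int[mu]_w (f w)%:E.
    by apply: integral_ge0 => w _; rewrite lee_fin.
  by split; [exact: fine_ge0|rewrite fineK// ge0_fin_numE].
have le1 f : nneg_measurable f -> (forall w, f w <= g0 w)%R ->
    \int[mu]_w (f w)%:E <= 1.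
  by move=> mf fg; rewrite -I0; apply: nneg_ae_le_integral => //; exact: aeW.
have le1_lty (x : \bar R) : x <= 1 -> x < +oo by move=> /le_lt_trans; apply; exact: ltry.
have Iphi1 : \int[mu]_w (phi w)%:E <= 1 by apply: le1 => // w; case/andP: (phib w).
have Ipsi1 : \int[mu]_w (psi w)%:E <= 1 by apply: le1 => // w; case/andP: (psib w).
have [a [a0 Ia]] := real_int _ mphi (le1_lty _ Iphi1).
have [b [b0 Ib]] := real_int _ mpsi (le1_lty _ Ipsi1).
have [D [D0 ID]] := real_int _ mG (affinity_lty u01 mg0 mg1 I0 I1).
have tu0 : (0 < t `^ u)%R by exact: powR_gt0.
have mtpsi : nneg_measurable (fun w => t `^ u * psi w)%R.
  by apply: nneg_measurableZ => //; exact: ltW.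
have Itpsi : \int[mu]_w (t `^ u * psi w)%:E = (t `^ u * b)%:E.
  by rewrite nneg_integralZ ?(ltW tu0)// Ib.
have Ichi_le : \int[mu]_w (chi w)%:E <= (t `^ u * b)%:E.
  by rewrite -Itpsi; apply: nneg_ae_le_integral => //; exact: aeW.
have [c [c0 Ic]] := real_int _ mchi (le_lt_trans Ichi_le (ltry _)).
have a1 : (a <= 1)%R by rewrite -lee_fin -Ia.
have b1 : (b <= 1)%R by rewrite -lee_fin -Ib.
have [a_eq0|an0] := eqVneq a 0%R.
  left; have : {ae mu, forall w, phi w = 0%R}.
    by apply: nneg_integral_eq0 => //; rewrite Ia a_eq0.
  apply: filterS => w; rewrite /phi; have [_ ->|_ /eqP] := leP (g0 w) _; first by left.
  by rewrite subr_eq0 => /eqP ->; right.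
have {}a_gt0 : (0 < a)%R by rewrite lt_def an0.
right.
(* Add e b phi and remove e a psi: both have mass e a b, so the perturbed [h] stays in the band.
   Maximality of g0 then compares gain with loss, and the common factor (1 - u) e a is divided
   out. *)
have step e : (0 < e < 1)%R -> (t `^ u * b * (1 - e * a) <= c * (1 + e * b))%R.
  move=> /andP[e0 e1].
  have ea0 : (0 <= e * a)%R by rewrite mulr_ge0// ltW.
  have eb0 : (0 <= e * b)%R by rewrite mulr_ge0// ltW.
  have ea1 : (e * a < 1)%R by rewrite (le_lt_trans _ e1)// ler_piMr// ltW.
  have eb1 : (e * b <= 1)%R by rewrite (le_trans _ (ltW e1))// ler_piMr// ltW.
  pose h w := (g0 w + e * b * phi w - e * a * psi w)%R.
  have mh : nneg_measurable h.
    split=> [|w].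
      by apply: measurable_funB; [apply: measurable_funD => //|];
        apply: measurable_funM => //; (exact: measurable_cst || (by case: mphi)
          || (by case: mpsi)).
    have /andP[p0 p1] := phib w; have /andP[q0 q1] := psib w.
    have := mulr_ge0 eb0 p0; have := ler_wpM2r q0 (ltW ea1).
    by rewrite /h; lra.
  have hU w : (h w <= gU w)%R.
    have /andP[p0 p1] := phib w; have /andP[q0 q1] := psib w.
    have := mulr_ge0 ea0 q0; have := ler_wpM2r p0 eb1.
    have : (phi w <= gU w - g0 w)%R by rewrite ge_min lexx orbT.
    by rewrite /h; lra.
  have Ih : \int[mu]_w (h w)%:E = 1.
    have meb := nneg_measurableZ eb0 mphi; have mea := nneg_measurableZ ea0 mpsi.
    have : \int[mu]_w (h w + e * a * psi w)%:E =
        \int[mu]_w (g0 w + e * b * phi w)%:E.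
      by apply: eq_integral => w _; rewrite /h subrK.
    rewrite (nneg_integralD mu mh mea) (nneg_integralD mu mg0 meb).
    rewrite (nneg_integralZ mu ea0 mpsi) (nneg_integralZ mu eb0 mphi).
    rewrite Ia Ib I0 -!EFinM.
    have -> : (e * a * b = e * b * a)%R by lra.
    by move/(congr1 (fun x : \bar R => x - (e * b * a)%:E)); rewrite !addeK.
  have bh : band mu gU h.
    by case: (mh) => mh' h0; split => //; apply: aeW => w; rewrite h0 hU.
  have := gmax _ bh; rewrite [affinity mu u g0 g1]ID => le_hD.
  pose H w := (g1 w `^ u * h w `^ (1 - u))%R.
  have mH : nneg_measurable H.
    by apply: nneg_measurable_affinity => //; case: mh.
  pose k := ((1 - u) * (e * a / (1 - e * a)))%R.
  pose l := (t `^ u * (1 - u) * (e * b / (1 + e * b)))%R.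
  have k0 : (0 <= k)%R by apply: mulr_ge0; [lra|rewrite divr_ge0//; lra].
  have l0 : (0 <= l)%R.
    by apply: mulr_ge0; [apply: mulr_ge0; lra|rewrite divr_ge0//; lra].
  have mk := nneg_measurableZ k0 mchi; have ml := nneg_measurableZ l0 mphi.
  have : \int[mu]_w (G w + l * phi w)%:E <= \int[mu]_w (H w + k * chi w)%:E.
    apply: nneg_ae_le_integral; [exact: nneg_measurableD|exact: nneg_measurableD|].
    apply: filterS stat => w gst; apply: affinity_exchange_ge => //.
      by rewrite ea0.
    move=> phi0; apply: gst; have /andP[_ p1] := phib w.
    rewrite (lt_le_trans phi0 p1) -subr_gt0 (lt_le_trans phi0)//.
    by rewrite ge_min lexx orbT.
  rewrite (nneg_integralD mu mG ml) (nneg_integralD mu mH mk).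
  rewrite (nneg_integralZ mu l0 mphi) (nneg_integralZ mu k0 mchi).
  rewrite ID Ia Ic -!EFinM -EFinD.
  move=> /le_trans /(_ (leeD2r _ le_hD)); rewrite -EFinD lee_fin lerD2l /l /k.
  have -> : (t `^ u * (1 - u) * (e * b / (1 + e * b)) * a =
      (1 - u) * e * a * (t `^ u * b / (1 + e * b)))%R by lra.
  have -> : ((1 - u) * (e * a / (1 - e * a)) * c =
      (1 - u) * e * a * (c / (1 - e * a)))%R by lra.
  rewrite ler_pM2l; last by rewrite !mulr_gt0//; lra.
  by rewrite ler_pdivrMr; [rewrite mulrAC ler_pdivlMr//|]; lra.
have tub_le : (t `^ u * b <= c)%R.
  rewrite leNgt; apply/negP => lt_c.
  set M := (t `^ u * b)%R in step lt_c *.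
  have M0 : (0 < M)%R by lra.
  have Mc : (0 < 2 * (M + c))%R by lra.
  (* This replaces the limit e -> 0. As a, b <= 1, [step] yields M - c <= e (M + c), whereas this
     [e] makes the right-hand side (M - c) / 2. *)
  pose e := ((M - c) / (2 * (M + c)))%R.
  have e0 : (0 < e)%R by rewrite divr_gt0//; lra.
  have e1 : (e < 1)%R by rewrite ltr_pdivrMr//; lra.
  have eE : (e * (M + c) = (M - c) / 2)%R by rewrite /e; field; lra.
  have := step e; rewrite e0 e1 => /(_ isT).
  have := ler_wpM2l (ltW (mulr_gt0 e0 M0)) a1.
  have := ler_wpM2l (mulr_ge0 (ltW e0) c0) b1.
  lra.
(* Pointwise chi <= t^u psi, and the integrals compare the other way, so the two agree almost
   everywhere. On {g1 < t * g0} the inequality is strict, hence that set is null. *)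
have chiE : {ae mu, forall w, chi w = (t `^ u * psi w)%R}.
  apply: nneg_ae_le_integral_eq => //.
  - exact: aeW.
  - by rewrite Itpsi Ic lee_fin.
  - by rewrite Ic ltry.
apply: filterS chiE => w; rewrite /chi /psi /G leNgt; case: ifPn => // yx E.
have g0w : (0 < g0 w)%R by rewrite -(pmulr_rgt0 _ t0) (le_lt_trans (g10 w)).
have : (g1 w `^ u < t `^ u * g0 w `^ u)%R.
  rewrite -powRM ?(ltW t0)//; apply: gt0_ltr_powR; rewrite ?nnegrE//.
  exact: le_trans (g10 w) (ltW yx).
rewrite -(ltr_pM2r (powR_gt0 (1 - u) g0w)) E -mulrA -powRD.
  by rewrite subrKC powRr1// ltxx.
by rewrite subrKC oner_eq0.
Qed.

End exchange.

(** * Stationary maximizers are clipped *)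

Section stationary_densities.
Context d (T : measurableType d) (R : realType).
Variable mu : {measure set T -> \bar R}.

(* [t] and [s] are the ratios g1 / g0 and g0 / g1 prescribed off the upper
   bounds, so the statement is symmetric in the two classes. *)
Lemma stationary_density (s t : R) (gU0 gU1 g0 g1 : T -> R) :
  (0 < t)%R -> (0 < s)%R ->
  nneg_measurable gU0 -> nneg_measurable gU1 ->
  nneg_measurable g0 -> nneg_measurable g1 ->
  (forall w, (g0 w <= gU0 w)%R) -> (forall w, (g1 w <= gU1 w)%R) ->
  \int[mu]_w (g0 w)%:E = 1 -> \int[mu]_w (g1 w)%:E = 1 ->
  ~ {ae mu, forall w, g0 w = g1 w} ->
  {ae mu, forall w, (g0 w < gU0 w)%R ->
    (0 < g0 w /\ g1 w = t * g0 w)%R \/ (g0 w = 0 /\ gU1 w = 0)%R} ->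
  {ae mu, forall w, (g1 w < gU1 w)%R ->
    (0 < g1 w /\ g0 w = s * g1 w)%R \/ (g1 w = 0 /\ gU0 w = 0)%R} ->
  {ae mu, forall w, g0 w = 0%R \/ g0 w = gU0 w} \/
    {ae mu, forall w, (t * g0 w <= g1 w)%R} ->
  {ae mu, forall w, g1 w = 0%R \/ g1 w = gU1 w} \/
    {ae mu, forall w, (s * g1 w <= g0 w)%R} ->
  ({ae mu, forall w, g0 w = 0%R \/ g0 w = gU0 w} ->
    normalization0 mu gU0 gU1 t) ->
  {ae mu, forall w, g0 w = clipped0 gU0 gU1 t w}.
Proof.
move=> t0 s0 mU0 mU1 mg0 mg1 g0U g1U I0 I1 neq S0 S1 E0 E1.
rewrite normalization0E// => N0.
have mc := nneg_measurable_clipped0 t0 mU0 mU1.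
have cE w := clipped0E t0 (mU0.2 w) (mU1.2 w).
case: E0 => [P0|Q0].
  have le_c : {ae mu, forall w, (clipped0 gU0 gU1 t w <= g0 w)%R}.
    apply: filterS2 P0 S0 => w g0E S0w; rewrite cE ge_min.
    have [//|lt_g0] := leP (gU0 w) (g0 w).
    case: (S0w lt_g0) => [[g0_gt0 _]|[_ ->]].
      by case: g0E => g0E; move: g0_gt0 lt_g0; rewrite g0E ltxx.
    by rewrite mulr0 (mg0.2 w).
  have := nneg_ae_le_integral_eq mc mg0 le_c.
  rewrite N0// I0 => /(_ (lexx _) (ltry _)).
  by apply: filterS => w ->.
(* Where both densities are strictly between 0 and their bounds, both ratios are prescribed, which
   requires s t = 1. In that case the two global inequalities give g1 = t g0, equal masses give t =
   1, and the densities coincide, contrary to [neq]. *)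
have excl : {ae mu, forall w, ~ [/\ (0 < g0 w)%R, (g0 w < gU0 w)%R,
    (0 < g1 w)%R & (g1 w < gU1 w)%R]}.
  case: E1 => [P1|Q1].
    apply: filterS P1 => w [g1E [_ _]|g1E [_ _ _]]; by rewrite g1E ltxx.
  have [st|st] := eqVneq (s * t)%R 1%R; last first.
    apply: filterS2 S0 S1 => w S0w S1w [x0 x1 y0 y1].
    case: (S0w x1) => [[_ e0]|[e0 _]]; last by rewrite e0 ltxx in x0.
    case: (S1w y1) => [[_ e1]|[e1 _]]; last by rewrite e1 ltxx in y0.
    move: e1; rewrite e0 mulrA => /eqP.
    by rewrite -subr_eq0 -{1}[g0 w]mul1r -mulrBl mulf_eq0 subr_eq0 eq_sym
      (negbTE st) gt_eqF.
  have e : {ae mu, forall w, g1 w = (t * g0 w)%R}.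
    apply: filterS2 Q0 Q1 => w q0 q1; apply/le_anti; rewrite q0 andbT.
    by have := ler_wpM2l (ltW t0) q1; rewrite mulrA [(t * s)%R]mulrC st mul1r.
  have t1 : t = 1%R.
    have mt := nneg_measurableZ (ltW t0) mg0.
    have := nneg_ae_eq_integral mg1 mt e; rewrite (nneg_integralZ mu (ltW t0) mg0).
    by rewrite I0 I1 mule1 => -[].
  by exfalso; apply: neq; apply: filterS e => w; rewrite t1 mul1r.
(* The upper estimate is g0 <= g1 / t <= gU1 / t. Conversely, where 0 < g0 < gU0, stationarity gives
   g1 = t g0 > 0 and [excl] forces g1 = gU1. *)
apply: filterS3 Q0 S0 excl => w q0 S0w ex; rewrite cE.
have tg : (g0 w <= t^-1 * gU1 w)%R.
  by rewrite mulrC ler_pdivlMr// mulrC (le_trans q0).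
apply/le_anti; rewrite le_min g0U tg ge_min /=.
have [//|lt_g0] := leP (gU0 w) (g0 w).
case: (S0w lt_g0) => [[g0_gt0 g1E]|[_ ->]]; last by rewrite mulr0 (mg0.2 w).
have [gU1_le|lt_g1] := leP (gU1 w) (g1 w).
  by rewrite mulrC ler_pdivrMr// mulrC -g1E.
by exfalso; apply: ex; split => //; rewrite g1E mulr_gt0.
Qed.

Lemma clipped1_clipped0 (t : R) (gU0 gU1 : T -> R) : (0 < t)%R ->
  (forall w, 0 <= gU0 w)%R -> (forall w, 0 <= gU1 w)%R ->
  clipped1 gU0 gU1 t = clipped0 gU1 gU0 t^-1.
Proof.
move=> t0 f0 g0; apply/funext => w.
by rewrite clipped1E// clipped0E// ?invr_gt0// invrK.
Qed.

(** Each density maximizes the affinity with the other held fixed, so the exchange lemma applies to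
    both. The second application swaps the classes, which turns [u] into 1 - u and the threshold [t]
    into its inverse. *)
Lemma least_favorable_stationary (gU0 gU1 g0 g1 : T -> R) (s t : R) :
  nneg_measurable gU0 -> nneg_measurable gU1 ->
  band mu gU0 `&` band mu gU1 = set0 -> (0 < s)%R -> (0 < t)%R ->
  least_favorable mu gU0 gU1 g0 g1 ->
  stationary0 mu gU0 gU1 g0 g1 s -> stationary1 mu gU0 gU1 g0 g1 t ->
  ({ae mu, forall w, g0 w = 0%R \/ g0 w = gU0 w} ->
    normalization0 mu gU0 gU1 s) ->
  ({ae mu, forall w, g1 w = 0%R \/ g1 w = gU1 w} ->
    normalization1 mu gU0 gU1 t) ->
  {ae mu, forall w, g0 w = clipped0 gU0 gU1 s w} /\
  {ae mu, forall w, g1 w = clipped1 gU0 gU1 t w}.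
Proof.
move=> mU0 mU1 disj s0 t0 [bg0 bg1 [u [u01 _ gmax]]] stat0 stat1 N0 N1.
have [y0 [by0 y0b g0y]] := band_truncated mU0 bg0.
have [y1 [by1 y1b g1y]] := band_truncated mU1 bg1.
have [[my0 _ I0] [my1 _ I1]] := (by0, by1).
have t'0 : (0 < t^-1)%R by rewrite invr_gt0.
have y0U w : (y0 w <= gU0 w)%R by case/andP: (y0b w).
have y1U w : (y1 w <= gU1 w)%R by case/andP: (y1b w).
have {}my0 : nneg_measurable y0 by split=> // w; case/andP: (y0b w).
have {}my1 : nneg_measurable y1 by split=> // w; case/andP: (y1b w).
have ymax : affinity mu u y0 y1 = max_affinity mu gU0 gU1 u.
  rewrite -gmax; apply/esym/affinity_ae_eq;
    [by case: bg0|by case: my0|by case: bg1|by case: my1|exact: g0y|exact: g1y].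
have E0 : {ae mu, forall w, (0 < y0 w < gU0 w)%R -> y1 w = (s * y0 w)%R} ->
    {ae mu, forall w, y0 w = 0%R \/ y0 w = gU0 w} \/
    {ae mu, forall w, (s * y0 w <= y1 w)%R}.
  apply: (affinity_max_exchange u01 s0 mU0 my0 my1 y0U I0 I1) => h bh.
  by rewrite ymax; apply: ereal_sup_ubound; exists (h, y1); split.
have E1 : {ae mu, forall w, (0 < y1 w < gU1 w)%R -> y0 w = (t^-1 * y1 w)%R} ->
    {ae mu, forall w, y1 w = 0%R \/ y1 w = gU1 w} \/
    {ae mu, forall w, (t^-1 * y1 w <= y0 w)%R}.
  have u01' : (0 < 1 - u < 1)%R by move: u01; lra.
  apply: (affinity_max_exchange u01' t'0 mU1 my1 my0 y1U I1 I0) => h bh.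
  by rewrite -!affinityC ymax; apply: ereal_sup_ubound; exists (y0, h); split.
clear u u01 gmax ymax.
have S0 : {ae mu, forall w, (y0 w < gU0 w)%R ->
    (0 < y0 w /\ y1 w = s * y0 w)%R \/ (y0 w = 0 /\ gU1 w = 0)%R}.
  apply: filterS3 stat0 g0y g1y => w + g0w g1w; rewrite /density_ratio g0w g1w.
  move=> S0w lt0; case: (S0w lt0) => [r|]; [left|by right].
  have [yn0 ?] := @density_ratio_eq_fin _ _ s y1 y0 w s0 (my1.2 w) r.
  by rewrite lt_def yn0 (my0.2 w).
have S1 : {ae mu, forall w, (y1 w < gU1 w)%R ->
    (0 < y1 w /\ y0 w = t^-1 * y1 w)%R \/ (y1 w = 0 /\ gU0 w = 0)%R}.
  apply: filterS3 stat1 g0y g1y => w + g0w g1w; rewrite /density_ratio g0w g1w.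
  move=> S1w lt1; case: (S1w lt1) => [r|]; [left|by right].
  have [yn0 ->] := @density_ratio_eq_fin _ _ t y1 y0 w t0 (my1.2 w) r.
  split; last by rewrite mulKf// gt_eqF.
  by apply: (mulr_gt0 t0); rewrite lt_def yn0 (my0.2 w).
have {}N0 : {ae mu, forall w, y0 w = 0%R \/ y0 w = gU0 w} ->
    normalization0 mu gU0 gU1 s.
  by move=> h; apply: N0; apply: filterS2 h g0y => w + ->.
have {}N1 : {ae mu, forall w, y1 w = 0%R \/ y1 w = gU1 w} ->
    normalization0 mu gU1 gU0 t^-1.
  move=> h; rewrite normalization0E// -clipped1_clipped0//; [|by case: mU0|by case: mU1].
  by rewrite -normalization1E//; apply: N1; apply: filterS2 h g1y => w + ->.
have neq : ~ {ae mu, forall w, y0 w = y1 w}.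
  move=> e; suff : (band mu gU0 `&` band mu gU1) y0 by rewrite disj.
  split; first exact: by0.
  split; [by case: my0| |exact: I0].
  by apply: filterS e => w ew; rewrite {2}ew (my0.2 w) y1U.
have {}E0 : {ae mu, forall w, y0 w = 0%R \/ y0 w = gU0 w} \/
    {ae mu, forall w, (s * y0 w <= y1 w)%R}.
  apply: E0; apply: filterS S0 => w S0w /andP[y_gt0 /S0w[[]//|[yw _]]].
  by rewrite yw ltxx in y_gt0.
have {}E1 : {ae mu, forall w, y1 w = 0%R \/ y1 w = gU1 w} \/
    {ae mu, forall w, (t^-1 * y1 w <= y0 w)%R}.
  apply: E1; apply: filterS S1 => w S1w /andP[y_gt0 /S1w[[]//|[yw _]]].
  by rewrite yw ltxx in y_gt0.
split.
  have h := stationary_density s0 t'0 mU0 mU1 my0 my1 y0U y1U I0 I1 neq S0 S1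
    E0 E1 N0.
  by apply: filterS2 g0y h => w ->.
have neq' : ~ {ae mu, forall w, y1 w = y0 w}.
  by move=> e; apply: neq; apply: filterS e => w ->.
have h := stationary_density t'0 s0 mU1 mU0 my1 my0 y1U y0U I1 I0 neq' S1 S0
  E1 E0 N1.
rewrite clipped1_clipped0//; [|by case: mU0|by case: mU1].
by apply: filterS2 g1y h => w ->.
Qed.

End stationary_densities.

(** * The clipped likelihood ratio and the final assembly *)

Lemma clipped_density_ratio (T : Type) (R : realType) (gU0 gU1 g0 g1 : T -> R)
    (s t : R) w : (0 < s)%R -> (s < t)%R ->
  (0 <= gU0 w)%R -> (0 <= gU1 w)%R ->
  g0 w = clipped0 gU0 gU1 s w -> g1 w = clipped1 gU0 gU1 t w ->
  ~ (g0 w = 0%R /\ g1 w = 0%R) ->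
  density_ratio g1 g0 w =
    if density_ratio gU1 gU0 w < s%:E then s%:E
    else if density_ratio gU1 gU0 w <= t%:E then density_ratio gU1 gU0 w
    else t%:E.
Proof.
move=> s0 st U0 U1; rewrite /clipped0 /clipped1 /density_ratio.
set l := (gU1 w)%:E / (gU0 w)%:E.
(* Since s < t, at most one density is clipped at each point. Excluding 0 / 0 makes the bound that
   cancels in the quotient nonzero. *)
case: (ltP l s%:E) => [ls|sl] ->.
  have lt : l <= t%:E by rewrite (le_trans (ltW ls))// lee_fin ltW.
  rewrite lt => -> nz.
  have U1n0 : gU1 w != 0%R by apply: contra_notN nz => /eqP ->; rewrite mulr0.
  rewrite inver mulf_eq0 invr_eq0 gt_eqF//= (negbTE U1n0) -EFinM; congr EFin.
  by field; rewrite U1n0 gt_eqF.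
case: (leP l t%:E) => [_ -> //|_ ->] nz.
have U0n0 : gU0 w != 0%R by apply: contra_notN nz => /eqP ->; rewrite mulr0.
by rewrite inver (negbTE U0n0) -EFinM mulfK.
Qed.

Theorem mainTheorem5 (d : measure_display) (T : measurableType d)
    (R : realType) (mu : {measure set T -> \bar R})
    (gU0 gU1 : T -> R)
    (gU0_meas : measurable_fun [set: T] gU0)
    (gU1_meas : measurable_fun [set: T] gU1)
    (gU0_ge0 : forall w, (0 <= gU0 w)%R)
    (gU1_ge0 : forall w, (0 <= gU1 w)%R)
    (gU0_mass : 1 <= \int[mu]_w (gU0 w)%:E)
    (gU1_mass : 1 <= \int[mu]_w (gU1 w)%:E)
    (band0_neq0 : band mu gU0 !=set0)
    (band1_neq0 : band mu gU1 !=set0)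
    (band_disj : band mu gU0 `&` band mu gU1 = set0)
    (g0 g1 : T -> R)
    (g_lf : least_favorable mu gU0 gU1 g0 g1)
    (k1 k2 tl tu : R)
    (k1_gt0 : (0 < k1)%R) (k2_gt0 : (0 < k2)%R)
    (tlE : tl = (1 / k2)%R) (tuE : tu = k1)
    (g_stat0 : stationary0 mu gU0 gU1 g0 g1 (1 / k2)%R)
    (g_stat1 : stationary1 mu gU0 gU1 g0 g1 k1)
    (* a constant left free by its stationarity condition (no point with
       0 < g_j < gU_j, up to a null set) is fixed by the normalization *)
    (k2_det : {ae mu, forall w, g0 w = 0%R \/ g0 w = gU0 w} ->
              normalization0 mu gU0 gU1 tl)
    (k1_det : {ae mu, forall w, g1 w = 0%R \/ g1 w = gU1 w} ->
              normalization1 mu gU0 gU1 tu) :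
  (* the densities *)
  [/\ {ae mu, forall w, g0 w = clipped0 gU0 gU1 tl w},
      {ae mu, forall w, g1 w = clipped1 gU0 gU1 tu w} &
  (* the likelihood ratio, wherever it is not 0 / 0 *)
      {ae mu, forall w, ~ (g0 w = 0%R /\ g1 w = 0%R) ->
        density_ratio g1 g0 w =
          if density_ratio gU1 gU0 w < tl%:E then tl%:E
          else if density_ratio gU1 gU0 w <= tu%:E then density_ratio gU1 gU0 w
          else tu%:E}] /\
  (* uniqueness *)
  (forall h0 h1 : T -> R, least_favorable mu gU0 gU1 h0 h1 ->
     {ae mu, forall w,
       [/\ h0 w = g0 w, h1 w = g1 w &
           density_ratio h1 h0 w = density_ratio g1 g0 w]}) /\
  (* the constraints *)
  [/\ forall w, (0 <= clipped0 gU0 gU1 tl w <= gU0 w)%R,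
      forall w, (0 <= clipped1 gU0 gU1 tu w <= gU1 w)%R,
      \int[mu]_w (clipped0 gU0 gU1 tl w)%:E = 1 &
      \int[mu]_w (clipped1 gU0 gU1 tu w)%:E = 1] /\
  (* the thresholds solve the normalization equations, and any positive
     solution yields the least favorable densities *)
  [/\ normalization0 mu gU0 gU1 tl,
      normalization1 mu gU0 gU1 tu &
      forall sl su : R, (0 < sl)%R -> (0 < su)%R ->
        normalization0 mu gU0 gU1 sl -> normalization1 mu gU0 gU1 su ->
        least_favorable mu gU0 gU1
          (clipped0 gU0 gU1 sl) (clipped1 gU0 gU1 su)].
Proof.
have mU0 : nneg_measurable gU0 by [].
have mU1 : nneg_measurable gU1 by [].
have tl_gt0 : (0 < tl)%R by rewrite tlE divr_gt0.
have tu_gt0 : (0 < tu)%R by rewrite tuE.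
rewrite -tlE in g_stat0; rewrite -tuE in g_stat1.
clear k1 k2 k1_gt0 k2_gt0 tlE tuE.
have [g0E g1E] := least_favorable_stationary mU0 mU1 band_disj tl_gt0 tu_gt0
  g_lf g_stat0 g_stat1 k2_det k1_det.
have [[m0 _ I0] [m1 _ I1] _] := g_lf.
have c0E : \int[mu]_w (clipped0 gU0 gU1 tl w)%:E = 1.
  rewrite -I0; apply: ae_eq_integral => //.
  - by apply/measurable_EFinP; case: (nneg_measurable_clipped0 tl_gt0 mU0 mU1).
  - exact/measurable_EFinP.
  - by apply: filterS g0E => w -> _.
have c1E : \int[mu]_w (clipped1 gU0 gU1 tu w)%:E = 1.
  rewrite -I1; apply: ae_eq_integral => //.
  - by apply/measurable_EFinP; case: (nneg_measurable_clipped1 tu_gt0 mU0 mU1).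
  - exact/measurable_EFinP.
  - by apply: filterS g1E => w -> _.
have tl_lt_tu : (tl < tu)%R.
  apply: (@lt_trans _ _ 1%R).
    exact: (normalized_lower_lt1 mU0 mU1 tl_gt0 band_disj c0E).
  exact: (normalized_upper_gt1 mU0 mU1 tu_gt0 band_disj c1E).
split; [split; [exact: g0E|exact: g1E|]|split; [|split]].
- apply: filterS2 g0E g1E => w g0w g1w.
  exact: clipped_density_ratio.
- move=> h0 h1 h_lf.
  have := least_favorable_unique mU0 mU1 tl_gt0 tl_lt_tu c0E c1E h_lf.
  apply: filterS3 g0E g1E => w g0w g1w [h0w h1w].
  by rewrite /density_ratio h0w h1w g0w g1w.
- split; [| |exact: c0E|exact: c1E] => w.
    exact: clipped0_bounds.
  exact: clipped1_bounds.
- split; [by rewrite normalization0E|by rewrite normalization1E|].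
  (* Disjointness of the bands gives sl < 1 < su for any positive solution, so the maximality
     results hold for these thresholds too. *)
  move=> sl su sl_gt0 su_gt0.
  rewrite (normalization0E mu sl_gt0 mU0 mU1) (normalization1E mu su_gt0 mU0 mU1).
  move=> sl0 su1; apply: (least_favorable_clipped mU0 mU1 _ _ sl0 su1 g_lf) => //.
  apply: (@lt_trans _ _ 1%R).
    exact: (normalized_lower_lt1 mU0 mU1 sl_gt0 band_disj sl0).
  exact: (normalized_upper_gt1 mU0 mU1 su_gt0 band_disj su1).
Qed.
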